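(* Let $n\ge 3$, let $(\mathfrak g,[\cdot,\cdot],\alpha)$ be a multiplicative Hom-Lie superalgebra over $\mathbb K$, let $R$ be a Rota-Baxter operator of weight $0$ on $(\mathfrak g,[\cdot,\cdot],\alpha)$, and let $\phi\in\wedge^{n-2}\mathfrak g^*$ be an even $(n-2)$-cochain satisfying $$\phi\wedge\delta\phi_X=0\ \text{ for all } X=(x_1,\dots,x_{n-3})\in\mathcal H(\mathfrak g)^{n-3},\qquad \phi\circ(\alpha\otimes\mathrm{Id}\otimes\dots\otimes\mathrm{Id})=\phi .$$ Then $R$ is a Rota-Baxter operator of weight $0$ on $(\mathfrak g,[\cdot,\dots,\cdot]_\phi,\alpha)$ if and only if for all $x_1,\dots,x_n\in\mathcal H(\mathfrak g)$ $$\sum_{1\le k<l\le n}(-1)^{k+l+1}(-1)^{\gamma^X_{kl}}\Big(\sum_{\substack{1\le i\le n\\ i\ne k,l}}\phi\big(R(x_1),\dots,\widehat{R(x_k)},\dots,x_i,\dots,\widehat{R(x_l)},\dots,R(x_n)\big)\Big)[R(x_k),R(x_l)]\in\ker(R),$$ where in the inner summand the arguments are $R(x_j)$ for $j\notin\{i,k,l\}$ and $x_i$ for $j=i$, in increasing order of index, with the $k$-th and $l$-th arguments omitted ($i$ may lie anywhere relative to $k,l$).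
   Context: $\mathbb K$ is an algebraically closed field of characteristic zero. For a $\mathbb Z_2$-graded linear space $V=V_{\overline 0}\oplus V_{\overline 1}$, $\mathcal H(V)=V_{\overline 0}\cup V_{\overline 1}$ and $|v|\in\mathbb Z_2$ is the degree of $v\in\mathcal H(V)$; a map is even if it preserves total degree ($\mathbb K$ being in degree $\overline 0$). A Hom-Lie superalgebra $(\mathfrak g,[\cdot,\cdot],\alpha)$ is a $\mathbb Z_2$-graded linear space with an even bilinear map $[\cdot,\cdot]$ and an even linear map $\alpha:\mathfrak g\to\mathfrak g$ such that for homogeneous $x,y,z$: $[x,y]=-(-1)^{|x||y|}[y,x]$ and $(-1)^{|x||z|}[\alpha(x),[y,z]]+(-1)^{|y||x|}[\alpha(y),[z,x]]+(-1)^{|z||y|}[\alpha(z),[x,y]]=0$. It is multiplicative if $\alpha([x,y])=[\alpha(x),\alpha(y)]$. $\wedge^{k}\mathfrak g^*$ is the space of super-skew-symmetric $k$-linear forms on $\mathfrak g$ (interchanging adjacent homogeneous arguments $x_i,x_{i+1}$ multiplies the value by $-(-1)^{|x_i||x_{i+1}|}$). A hat denotes omission. Put $\gamma^X_{ij}=(|x_{j+1}|+\dots+|x_n|)(|x_i|+|x_j|)+|x_i|(|x_{i+1}|+\dots+|x_{j-1}|)$, and similarly $\gamma^Y_{ij}$ for $y_1,\dots,y_n$. The $n$-ary product is $$[x_1,\dots,x_n]_\phi=\sum_{i<j}(-1)^{i+j+1}(-1)^{\gamma^X_{ij}}\phi(x_1,\dots,\widehat{x_i},\dots,\widehat{x_j},\dots,x_n)[x_i,x_j]$$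 on homogeneous elements, extended multilinearly. For $X=(x_1,\dots,x_{n-3})$, $\phi_X(z)=\phi(x_1,\dots,x_{n-3},z)$ and $$\phi\wedge\delta\phi_X(y_1,\dots,y_n)=\sum_{i<j}(-1)^{i+j}(-1)^{\gamma^Y_{ij}}\phi(y_1,\dots,\widehat{y_i},\dots,\widehat{y_j},\dots,y_n)\phi_X([y_i,y_j]).$$ For a $\mathbb Z_2$-graded space $\mathcal N$ with an even $m$-linear bracket and an even linear map $\alpha$, a Rota-Baxter operator of weight $0$ on $(\mathcal N,[\cdot,\dots,\cdot],\alpha)$ is an even linear map $R:\mathcal N\to\mathcal N$ with $R\alpha=\alpha R$ and $$[R(x_1),\dots,R(x_m)]=R\Big(\sum_{i=1}^m[R(x_1),\dots,R(x_{i-1}),x_i,R(x_{i+1}),\dots,R(x_m)]\Big)\quad\text{for all }x_1,\dots,x_m\in\mathcal N.$$ *)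

(* Defs.v *)
From HB Require Import structures.
From mathcomp Require Export all_boot all_order all_fingroup all_algebra.
Set Implicit Arguments.
Unset Strict Implicit.
Unset Printing Implicit Defensive.
Import GRing.Theory.
Local Open Scope ring_scope.

(* The component maps [gcomp] are determined by the two subspaces; they are kept
   as data so that maps given on homogeneous elements can be extended. *)
Record Z2grading (K : fieldType) (V : lmodType K) := {
  gpart :> 'Z_2 -> {pred V};
  gcomp : 'Z_2 -> V -> V;
  gpart_submod : forall a, submod_closed (gpart a);
  gcomp_part : forall a v, gcomp a v \in gpart a;
  gcomp_sum : forall v, v = gcomp 0 v + gcomp 1 v;
  gpart_disjoint : forall v, v \in gpart 0 -> v \in gpart 1 -> v = 0
}.

(* Since 0 is homogeneous of both degrees, the degrees of homogeneous arguments
   are always carried explicitly, as a family d with x_i in the part d_i. *)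
Definition homogeneous (K : fieldType) (V : lmodType K) (gr : Z2grading V)
    (m : nat) (d : m.-tuple 'Z_2) (x : m.-tuple V) : Prop :=
  forall i : 'I_m, tnth x i \in gr (tnth d i).

Definition sg (K : fieldType) (a : 'Z_2) : K := (-1) ^+ a.

Definition even_map (K : fieldType) (V : lmodType K) (gr : Z2grading V)
    (f : V -> V) : Prop :=
  forall (a : 'Z_2) (v : V), v \in gr a -> f v \in gr a.

Record hom_lie_superalgebra (K : fieldType) (V : lmodType K)
    (gr : Z2grading V) (br : {bilinear V -> V -> V}) (alpha : {linear V -> V}) :
    Prop := {
  hls_bracket_even : forall (a b : 'Z_2) (x y : V),
    x \in gr a -> y \in gr b -> br x y \in gr (a + b);
  hls_alpha_even : even_map gr alpha;
  hls_skew : forall (a b : 'Z_2) (x y : V), x \in gr a -> y \in gr b ->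
    br x y = - (sg K (a * b) *: br y x);
  hls_jacobi : forall (a b c : 'Z_2) (x y z : V),
    x \in gr a -> y \in gr b -> z \in gr c ->
    sg K (a * c) *: br (alpha x) (br y z)
    + sg K (b * a) *: br (alpha y) (br z x)
    + sg K (c * b) *: br (alpha z) (br x y) = 0
}.

Definition hls_multiplicative (K : fieldType) (V : lmodType K)
    (br : {bilinear V -> V -> V}) (alpha : {linear V -> V}) : Prop :=
  forall x y : V, alpha (br x y) = br (alpha x) (alpha y).

Definition set_arg (T : Type) (m : nat) (x : m.-tuple T) (i : 'I_m) (u : T) :
    m.-tuple T :=
  [tuple if j == i then u else tnth x j | j < m].

Record super_skew_form (K : fieldType) (V : lmodType K) (gr : Z2grading V)
    (m : nat) (phi : m.-tuple V -> K) : Prop := {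
  ssf_multilinear : forall (i : 'I_m) (x : m.-tuple V),
    scalar (fun u => phi (set_arg x i u));
  ssf_skew : forall (d : m.-tuple 'Z_2) (x : m.-tuple V) (i j : 'I_m),
    homogeneous gr d x -> j = i.+1 :> nat ->
    phi [tuple tnth x (tperm i j k) | k < m]
    = - (sg K (tnth d i * tnth d j) * phi x)
}.

(* K sits in degree 0. *)
Definition even_form (K : fieldType) (V : lmodType K) (gr : Z2grading V)
    (m : nat) (phi : m.-tuple V -> K) : Prop :=
  forall (d : m.-tuple 'Z_2) (x : m.-tuple V),
    homogeneous gr d x -> \sum_(i < m) tnth d i != 0 -> phi x = 0.

(* For i != j the filtered sequence has exactly n - 2 entries, so the default
   value of nth is not reached. *)
Definition omit2 (K : fieldType) (V : lmodType K) (n : nat) (x : n.-tuple V)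
    (i j : 'I_n) : (n - 2).-tuple V :=
  [tuple nth 0 [seq tnth x k | k <- enum 'I_n & (k != i) && (k != j)] l
    | l < n - 2].

Definition gamma (n : nat) (d : n.-tuple 'Z_2) (i j : 'I_n) : 'Z_2 :=
  (\sum_(k < n | (j < k)%N) tnth d k) * (tnth d i + tnth d j)
  + tnth d i * \sum_(k < n | (i < k < j)%N) tnth d k.

(* Indices start at 0 here; shifting both i and j by one does not change the
   parity of i + j. *)
Definition phi_product_homog (K : fieldType) (V : lmodType K)
    (br : V -> V -> V) (n : nat) (phi : (n - 2).-tuple V -> K)
    (d : n.-tuple 'Z_2) (x : n.-tuple V) : V :=
  \sum_(i < n) \sum_(j < n | (i < j)%N)
    ((-1) ^+ (i + j + 1) * sg K (gamma d i j) * phi (omit2 x i j))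
      *: br (tnth x i) (tnth x j).

(* Multilinear extension: the sum over all choices of homogeneous components. *)
Definition phi_product (K : fieldType) (V : lmodType K) (gr : Z2grading V)
    (br : V -> V -> V) (n : nat) (phi : (n - 2).-tuple V -> K)
    (x : n.-tuple V) : V :=
  \sum_(d : n.-tuple 'Z_2)
    phi_product_homog br phi d [tuple gcomp gr (tnth d i) (tnth x i) | i < n].

(* For 3 <= n the sequence rcons X z has exactly n - 2 entries. *)
Definition phi_at (K : fieldType) (V : lmodType K) (n : nat)
    (phi : (n - 2).-tuple V -> K) (X : (n - 3).-tuple V) (z : V) : K :=
  phi [tuple nth 0 (rcons X z) l | l < n - 2].

Definition phi_wedge_delta (K : fieldType) (V : lmodType K)
    (br : V -> V -> V) (n : nat) (phi : (n - 2).-tuple V -> K)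
    (X : (n - 3).-tuple V) (d : n.-tuple 'Z_2) (y : n.-tuple V) : K :=
  \sum_(i < n) \sum_(j < n | (i < j)%N)
    (-1) ^+ (i + j) * sg K (gamma d i j) * phi (omit2 y i j)
      * phi_at phi X (br (tnth y i) (tnth y j)).

Definition alpha_first (V : Type) (m : nat) (alpha : V -> V) (x : m.-tuple V) :
    m.-tuple V :=
  [tuple if l == 0%N :> nat then alpha (tnth x l) else tnth x l | l < m].

Record rota_baxter0 (K : fieldType) (V : lmodType K) (gr : Z2grading V)
    (m : nat) (br : m.-tuple V -> V) (alpha R : {linear V -> V}) : Prop := {
  rb_even : even_map gr R;
  rb_comm : forall v : V, R (alpha v) = alpha (R v);
  rb_eq : forall x : m.-tuple V,
    br [tuple R (tnth x j) | j < m]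
    = R (\sum_(i < m)
          br [tuple if j == i then tnth x j else R (tnth x j) | j < m])
}.

Definition binary (V : Type) (br : V -> V -> V) (x : 2.-tuple V) : V :=
  br (tnth x ord0) (tnth x ord_max).

(* Main.v *)
Require Import Defs.
Import GRing.Theory.
Local Open Scope ring_scope.
Set Implicit Arguments.
Unset Strict Implicit.

(** The condition of the statement is exactly the obstruction to the n-ary
    Rota-Baxter identity. In the product of [R x_1, ..., R x_n] every bracket
    [R x_k, R x_l] is R applied to [x_k, R x_l] + [R x_k, x_l], because R is a
    Rota-Baxter operator for the binary bracket. On the right-hand side, the
    (k, l) term of the summand of index i is one of these two brackets when
    i is k or l, with the same coefficient and the same value of phi, since phi
    does not see the arguments of index k and l. Hence the two sides differ by
    R of the terms with i different from k and l, which is the sum in the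
    condition; this is [rota_baxter_gap_homog].

    It remains to pass between arbitrary and homogeneous arguments. As R is
    even, it commutes with the projections onto the homogeneous components, so
    the gap for arbitrary x is the sum, over all families d of degrees, of the
    gaps for the components of x of degrees d ([rota_baxter_gap]); the condition
    therefore implies the identity. Conversely, if x is homogeneous of degrees
    d, then for any other family of degrees some component of x is 0, the
    corresponding obstruction vanishes ([obstruction0]), and the identity at x
    says that R kills the single obstruction left. *)

Section Grading.
Variables (K : fieldType) (V : lmodType K) (gr : Z2grading V).

Lemma part_sub (a : 'Z_2) (u v : V) :
  u \in gr a -> v \in gr a -> u - v \in gr a.
Proof.
move=> ua va; rewrite -scaleN1r addrC.
exact: (gpart_submod gr a).2.
Qed.

Lemma Z2_cases (a : 'Z_2) : a = 0 \/ a = 1.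
Proof.
by case: a => [[|[|//]] lt_a]; [left | right]; apply/val_inj.
Qed.

(** The grading is a direct sum, so the component maps are forced. *)
Lemma gcomp_unique (v u0 u1 : V) : u0 \in gr 0 -> u1 \in gr 1 ->
  v = u0 + u1 -> gcomp gr 0 v = u0 /\ gcomp gr 1 v = u1.
Proof.
move=> u0P u1P vE.
have eq01 : gcomp gr 0 v - u0 = u1 - gcomp gr 1 v.
  apply/eqP; rewrite subr_eq addrAC eq_sym subr_eq eq_sym.
  by rewrite -gcomp_sum vE addrC.
have z0 : gcomp gr 0 v - u0 = 0.
  apply: (gpart_disjoint (z := gr)); first exact: part_sub (gcomp_part _ _ _) _.
  by rewrite eq01; exact: part_sub _ (gcomp_part _ _ _).
split; first exact: subr0_eq.
by apply/esym/subr0_eq; rewrite -eq01.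
Qed.

Lemma part0 (a : 'Z_2) : 0 \in gr a.
Proof. exact: (gpart_submod gr a).1. Qed.

Lemma gcomp_homog (a b : 'Z_2) (v : V) : v \in gr a ->
  gcomp gr b v = if b == a then v else 0.
Proof.
case: (Z2_cases a) => ->{a} va.
  have [c0 c1] := gcomp_unique va (part0 1) (esym (addr0 v)).
  by case: (Z2_cases b) => ->.
have [c0 c1] := gcomp_unique (part0 0) va (esym (add0r v)).
by case: (Z2_cases b) => ->.
Qed.

Lemma gcomp_even_map (f : {linear V -> V}) (a : 'Z_2) (v : V) :
  even_map gr f -> gcomp gr a (f v) = f (gcomp gr a v).
Proof.
move=> f_even; have part_f b := f_even b _ (gcomp_part gr b v).
have [c0 c1] := gcomp_unique (part_f 0) (part_f 1)
  (etrans (congr1 f (gcomp_sum gr v)) (linearD f _ _)).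
by case: (Z2_cases a) => ->.
Qed.

Lemma super_skew_form0 (m : nat) (phi : m.-tuple V -> K) (i : 'I_m)
    (x : m.-tuple V) : super_skew_form gr phi -> tnth x i = 0 -> phi x = 0.
Proof.
move=> phi_form xi0; have -> : x = set_arg x i 0.
  by apply: eq_from_tnth => j; rewrite tnth_mktuple; case: eqP => // ->.
(* Linearity in position i at (-1) *: 0 + 0 reads f 0 = - f 0 + f 0. *)
have := ssf_multilinear phi_form i x (-1) 0 0.
by rewrite scaler0 addr0 mulN1r addNr.
Qed.

End Grading.

Section Omit2.
Variables (K : fieldType) (V : lmodType K) (n : nat).

(** The source of the cancellation: phi cannot tell the tuple with R applied
    everywhere from the one with R left out at index k or l. *)
Lemma eq_omit2 (x y : n.-tuple V) (k l : 'I_n) :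
  (forall j, j != k -> j != l -> tnth x j = tnth y j) ->
  omit2 x k l = omit2 y k l.
Proof.
move=> eq_xy; apply: eq_from_tnth => p; rewrite !tnth_mktuple.
congr (nth _ _ _); apply/eq_in_map => j.
by rewrite mem_filter => /andP[/andP[]]; auto.
Qed.

(** The only point that needs the count of the indices other than k and l: the
    tuple has length n - 2, so no entry is truncated away. *)
Lemma omit2_tnth (x : n.-tuple V) (i k l : 'I_n) :
  k != l -> i != k -> i != l -> exists p, tnth (omit2 x k l) p = tnth x i.
Proof.
move=> neq_kl neq_ik neq_il.
pose s := [seq j <- enum 'I_n | (j != k) && (j != l)].
have size_s : size s = (n - 2)%N.
  have <- : #|predC (pred2 k l)| = (n - 2)%N.
    by rewrite -[X in (X - 2)%N]card_ord -(cardC (pred2 k l)) card2 neq_kl addKn.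
  rewrite cardE /enum_mem -enumT; congr size; apply: eq_filter => j.
  by rewrite !inE negb_or.
have i_s : i \in s by rewrite mem_filter neq_ik neq_il mem_enum.
have lt_i : (index i s < n - 2)%N by rewrite -size_s index_mem.
exists (Ordinal lt_i).
by rewrite tnth_mktuple (nth_map i) ?nth_index ?index_mem.
Qed.

End Omit2.

Section RotaBaxter.
Variables (K : fieldType) (V : lmodType K) (gr : Z2grading V).
Variables (br : {bilinear V -> V -> V}) (R : {linear V -> V}).
Variables (n : nat) (phi : (n - 2).-tuple V -> K).

Definition map_all (x : n.-tuple V) : n.-tuple V :=
  [tuple R (tnth x j) | j < n].

Definition map_except (x : n.-tuple V) (i : 'I_n) : n.-tuple V :=
  [tuple if j == i then tnth x j else R (tnth x j) | j < n].

Definition components (d : n.-tuple 'Z_2) (x : n.-tuple V) : n.-tuple V :=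
  [tuple gcomp gr (tnth d i) (tnth x i) | i < n].

Definition obstruction (d : n.-tuple 'Z_2) (x : n.-tuple V) : V :=
  \sum_(k < n) \sum_(l < n | (k < l)%N)
    ((-1) ^+ (k + l + 1) * sg K (gamma d k l)
      * \sum_(i < n | (i != k) && (i != l)) phi (omit2 (map_except x i) k l))
      *: br (R (tnth x k)) (R (tnth x l)).

(** Since phi and the bracket both vanish as soon as one argument does, so does
    each term: the index of a zero argument is k or l, or occurs in phi. *)
Lemma obstruction0 (d : n.-tuple 'Z_2) (x : n.-tuple V) (i0 : 'I_n) :
  super_skew_form gr phi -> tnth x i0 = 0 -> obstruction d x = 0.
Proof.
move=> phi_form x0; apply: big1 => k _; apply: big1 => l lt_kl.
have [<-|neq_k] := eqVneq i0 k; first by rewrite x0 linear0 linear0l scaler0.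
have [<-|neq_l] := eqVneq i0 l; first by rewrite x0 linear0 linear0r scaler0.
rewrite big1 ?mulr0 ?scale0r // => i _.
have neq_kl : k != l by rewrite neq_ltn lt_kl.
have [p pE] := omit2_tnth (map_except x i) neq_kl neq_k neq_l.
apply: super_skew_form0 phi_form (etrans pE _).
by rewrite tnth_mktuple x0 linear0 if_same.
Qed.

Hypothesis R_rb2 :
  forall u v : V, br (R u) (R v) = R (br u (R v) + br (R u) v).

(** Term by term in k < l: the summands i = k and i = l rebuild the product of
    the [R x_j] through the binary identity, and the others are left over. This
    holds for an arbitrary tuple x, as the degrees d only enter the signs. *)
Lemma rota_baxter_gap_homog (d : n.-tuple 'Z_2) (x : n.-tuple V) :
  R (\sum_(i < n) phi_product_homog br phi d (map_except x i))
  = phi_product_homog br phi d (map_all x) + R (obstruction d x).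
Proof.
rewrite exchange_big linear_sum [X in _ + X]linear_sum -big_split /=.
apply: eq_bigr => k _.
rewrite exchange_big linear_sum [X in _ + X]linear_sum -big_split /=.
apply: eq_bigr => l lt_kl.
have neq_kl : k != l by rewrite neq_ltn lt_kl.
have neq_lk : l != k by rewrite eq_sym.
rewrite !tnth_mktuple R_rb2 -linearZ -linearD; congr (R _).
(* Isolate i = k and i = l; the remaining i are those of the obstruction. *)
rewrite (bigD1 k) //= (bigD1 l) //= addrA; congr (_ + _).
  have omit_k : omit2 (map_except x k) k l = omit2 (map_all x) k l.
    by apply: eq_omit2 => j /negPf jk _; rewrite !tnth_mktuple jk.
  have omit_l : omit2 (map_except x l) k l = omit2 (map_all x) k l.
    by apply: eq_omit2 => j _ /negPf jl; rewrite !tnth_mktuple jl.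
  rewrite omit_k omit_l !tnth_mktuple !eqxx (negPf neq_kl) (negPf neq_lk).
  by rewrite -scalerDr.
rewrite mulr_sumr scaler_suml; apply: eq_bigr => i /andP[ik il].
by rewrite !tnth_mktuple [k == i]eq_sym [l == i]eq_sym (negPf ik) (negPf il) R_rb2.
Qed.

Hypothesis R_even : even_map gr R.

(** Summing over d works because R, being even, may be moved across the
    projections onto components, also when one index is left out. *)
Lemma rota_baxter_gap (x : n.-tuple V) :
  R (\sum_(i < n) phi_product gr br phi (map_except x i))
  = phi_product gr br phi (map_all x)
    + R (\sum_(d : n.-tuple 'Z_2) obstruction d (components d x)).
Proof.
have comp_all d : components d (map_all x) = map_all (components d x).
  apply: eq_from_tnth => j; rewrite !tnth_mktuple; exact: gcomp_even_map.
have comp_except d i :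
    components d (map_except x i) = map_except (components d x) i.
  apply: eq_from_tnth => j; rewrite !tnth_mktuple.
  by case: eqP => // _; apply: gcomp_even_map.
rewrite exchange_big linear_sum [X in _ + X]linear_sum -big_split /=.
apply: eq_bigr => d _; rewrite -/(components _ _) comp_all.
rewrite -rota_baxter_gap_homog; congr (R _).
by apply: eq_bigr => i _; rewrite -/(components _ _) comp_except.
Qed.

End RotaBaxter.

Theorem proposition4p3 (K : closedFieldType) (charK : [pchar K] =i pred0)
  (n : nat) (n_ge3 : (3 <= n)%N)
  (g : lmodType K) (gr : Z2grading g)
  (br : {bilinear g -> g -> g}) (alpha : {linear g -> g})
  (g_hls : hom_lie_superalgebra gr br alpha)
  (g_mult : hls_multiplicative br alpha)
  (R : {linear g -> g}) (R_rb : rota_baxter0 gr (binary br) alpha R)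
  (phi : (n - 2).-tuple g -> K)
  (phi_form : super_skew_form gr phi) (phi_even : even_form gr phi)
  (phi_wedge : forall (e : (n - 3).-tuple 'Z_2) (X : (n - 3).-tuple g),
     homogeneous gr e X ->
     forall (d : n.-tuple 'Z_2) (y : n.-tuple g), homogeneous gr d y ->
     phi_wedge_delta br phi X d y = 0)
  (phi_alpha : forall x : (n - 2).-tuple g, phi (alpha_first alpha x) = phi x) :
  rota_baxter0 gr (phi_product gr br phi) alpha R <->
  (forall (d : n.-tuple 'Z_2) (x : n.-tuple g), homogeneous gr d x ->
     R (\sum_(k < n) \sum_(l < n | (k < l)%N)
          ((-1) ^+ (k + l + 1) * sg K (gamma d k l)
            * \sum_(i < n | (i != k) && (i != l))
                phi (omit2
                  [tuple if j == i then tnth x j else R (tnth x j) | j < n] k l))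
            *: br (R (tnth x k)) (R (tnth x l))) = 0).
Proof.
have [R_even R_alpha R_eq] := R_rb.
have R_rb2 u v : br (R u) (R v) = R (br u (R v) + br (R u) v).
  have := R_eq [tuple u; v].
  by rewrite /binary big_ord_recl big_ord1 !tnth_mktuple.
have gap := rota_baxter_gap phi R_rb2 R_even.
split=> [[_ _ rb_phi] d x x_homog | obs0].
  (* The identity at x says that the whole sum of obstructions is killed by R;
     homogeneity leaves only the summand of degrees d. *)
  have := gap x; rewrite -rb_phi -{1}[LHS]addr0 => /addrI/esym.
  rewrite (bigD1 d) //= big1 => [|e neq_ed].
    rewrite addr0; have -> // : components gr d x = x.
    apply: eq_from_tnth => i.
    by rewrite tnth_mktuple (gcomp_homog _ (x_homog i)) eqxx.
  have [i neq_i] : exists i, tnth e i != tnth d i.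
    apply/existsP; apply: contraNT neq_ed => /existsPn eq_ed.
    by apply/eqP/eq_from_tnth => i; apply/eqP; rewrite -[_ == _]negbK.
  have xi0 : tnth (components gr e x) i = 0.
    by rewrite tnth_mktuple (gcomp_homog _ (x_homog i)) (negPf neq_i).
  exact: obstruction0 phi_form xi0.
split=> // x; rewrite [RHS]gap linear_sum big1 ?addr0 // => d _.
by apply: obs0 => i; rewrite tnth_mktuple gcomp_part.
Qed.
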